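(* Let $T_1$ and $T_2$ be inverse semigroups, let $S$ be a semigroup, and let $\phi_i:S\to T_i$, $i=1,2$, be monomorphisms such that $S\phi_i$ is rich ample in $T_i$ for each $i\in\{1,2\}$. If $S$ is not an inverse semigroup, then the amalgam $(S;T_1,T_2;\phi_1,\phi_2)$ is weakly embeddable in an inverse semigroup, but it is not strongly embeddable in an inverse semigroup.
   Context: Maps are written to the right of their arguments; a monomorphism is an injective semigroup homomorphism. For $x$ in an inverse semigroup, $x^{-1}$ denotes its unique inverse. For a subsemigroup $U$ of an inverse semigroup $T$, put $U'=\{u^{-1}\in T:u\in U\}$. $U$ is rich right ample in $T$ if $x^{-1}y\in U\cup U'$ for all $x,y\in U$; rich left ample in $T$ if $xy^{-1}\in U\cup U'$ for all $x,y\in U$; and rich ample in $T$ if it is both. A semigroup amalgam $(S;T_1,T_2;\phi_1,\phi_2)$ consists of pairwise disjoint semigroups $S,T_1,T_2$ (disjointness can be arranged by passing to isomorphic copies) and monomorphisms $\phi_i:S\to T_i$, $i=1,2$. It is strongly embeddable in a semigroup $T$ if there exist monomorphisms $\psi_i:T_i\to T$, $i=1,2$, such that (i) $\phi_1\psi_1=\phi_2\psi_2$ (first $\phi_i$, then $\psi_i$), and (ii) for all $t_1\in T_1$, $t_2\in T_2$, if $t_1\psi_1=t_2\psi_2$ then there is $s\in S$ with $t_1=s\phi_1$ and $t_2=s\phi_2$. It is weakly embeddable in $T$ if there exist such monomorphisms satisfying (i), with (ii) not required. *)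

(* Defs.v *)
From mathcomp Require Import all_boot.
From mathcomp Require Import boolp classical_sets.

Set Implicit Arguments.
Unset Strict Implicit.
Unset Printing Implicit Defensive.

Local Open Scope group_scope.
Local Open Scope classical_set_scope.

(* [semigroupType] includes a choice structure; classically every type has one
   ([boolp.gen_choiceMixin]), so this does not restrict the semigroups.       *)

Definition inverse_of (T : semigroupType) (x y : T) : Prop :=
  x * y * x = x /\ y * x * y = y.

Definition inverse_semigroup (T : semigroupType) : Prop :=
  forall x : T, exists! y : T, inverse_of x y.

(* The default value [x] of [xget] is irrelevant when [T] is an inverse
   semigroup: see [sinvP] and [sinv_unique].                                  *)
Definition sinv (T : semigroupType) (x : T) : T := xget x [set y | inverse_of x y].

Lemma sinvP (T : semigroupType) (x : T) :
  inverse_semigroup T -> inverse_of x (sinv x).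
Proof.
by move=> /(_ x)[y [xy _]]; apply: (@xgetPex _ x [set y | inverse_of x y]); exists y.
Qed.

Lemma sinv_unique (T : semigroupType) (x y : T) :
  inverse_semigroup T -> inverse_of x y -> y = sinv x.
Proof.
move=> invT xy; have := sinvP x invT.
by have [z [_ uniq_z]] := invT x => /uniq_z <-; rewrite (uniq_z _ xy).
Qed.

Definition inverse_set (T : semigroupType) (U : set T) : set T :=
  [set sinv u | u in U].

Definition rich_right_ample (T : semigroupType) (U : set T) : Prop :=
  forall x y : T, U x -> U y -> (U `|` inverse_set U) (sinv x * y).

Definition rich_left_ample (T : semigroupType) (U : set T) : Prop :=
  forall x y : T, U x -> U y -> (U `|` inverse_set U) (x * sinv y).

Definition rich_ample (T : semigroupType) (U : set T) : Prop :=
  rich_right_ample U /\ rich_left_ample U.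

(* Carriers of an amalgam are separate types, which stands for their pairwise
   disjointness: elements are only ever compared through the given maps.      *)
Definition weakly_embeddable (S T1 T2 : semigroupType)
    (phi1 : {multiplicative S -> T1}) (phi2 : {multiplicative S -> T2})
    (T : semigroupType) : Prop :=
  exists (psi1 : {multiplicative T1 -> T}) (psi2 : {multiplicative T2 -> T}),
    [/\ injective psi1, injective psi2 &
        forall s : S, psi1 (phi1 s) = psi2 (phi2 s)].

Definition strongly_embeddable (S T1 T2 : semigroupType)
    (phi1 : {multiplicative S -> T1}) (phi2 : {multiplicative S -> T2})
    (T : semigroupType) : Prop :=
  exists (psi1 : {multiplicative T1 -> T}) (psi2 : {multiplicative T2 -> T}),
    [/\ injective psi1, injective psi2,
        forall s : S, psi1 (phi1 s) = psi2 (phi2 s) &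
        forall (t1 : T1) (t2 : T2), psi1 t1 = psi2 t2 ->
          exists s : S, t1 = phi1 s /\ t2 = phi2 s].

(* Main.v *)
Require Import Defs.
From mathcomp Require Import all_boot.
From mathcomp Require Import boolp classical_sets.
From HB Require Import structures.

(**
  Weak embeddability. Write [U_i] for the range of [phi_i] and [U_i'] for the
  set of inverses of its elements. Rich ampleness makes [H_i = U_i U U_i'] an
  inverse subsemigroup of [T_i]: a product of two elements of [H_i] is in [U_i],
  in [U_i'], or of the form [x^-1 y] or [x y^-1]. Moreover [H_1] and [H_2] are
  isomorphic over [S]. For [x] in [S] the idempotent [x^-1 x] lies in [U_i], and
  its preimage is determined by the multiplication of [S] alone, as the least
  idempotent [e] with [x e = x]; dually for [x x^-1]. The relation
  [u = x^-1 y] is then the conjunction of [x u = (x x^-1) y] and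
  [(x^-1 x) u = u], two equations between elements of [S], so that it holds in
  [T_1] if and only if it holds in [T_2] ([transfer_divl], [transfer_divr]).
  Hence the pairs of corresponding elements form an inverse semigroup
  ([hull_invSemigroup]) that projects injectively to [T_1] and to [T_2], and it
  remains to embed an amalgam of inverse semigroups: this is half of Hall's
  theorem ([weak_amalgamation]).

  The amalgam of [T_1] and [T_2] over [V] is embedded into the partial
  bijections of a set [Z] on which [T_1] and [T_2] act faithfully and agree on
  [V]. The engine is an extension property: when [V] acts on [X], the action
  extends to an action of a larger semigroup [T] on some [X + C], in such a way
  that [V] preserves [X] and acts there as before ([ext], [ext_old]); the points
  of [X + C] are the elements [x (x) t] of a tensor product of [X] with [T] over
  [V]. Start from the Wagner-Preston action of [T_1] on [X_0] and alternate: the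
  action of [V] on [X_k] extends to an action of [T_2] on [X_k + D_k], and the
  resulting action of [V] on the new part [D_k] extends to an action of [T_1] on
  [D_k + X_(k+1)]. On the disjoint union of all layers, [T_2] acts through the
  blocks [X_k + D_k], while [T_1] acts through [X_0] and the blocks
  [D_k + X_(k+1)]; both restrict to the same action of [V] ([total_agree]), and
  [T_1] acts faithfully because of [X_0]. Adding the set obtained with the roles
  of [T_1] and [T_2] exchanged makes both actions faithful.

  Failure of strong embeddability. Inverses are unique in an inverse semigroup,
  so the inverses of [phi_1 s] and of [phi_2 s] get the same image in any inverse
  semigroup in which the amalgam embeds. If the embedding is strong they come
  from an element of [S], which is an inverse of [s]; then [S] is an inverse
  semigroup.
*)

Set Implicit Arguments.
Unset Strict Implicit.
Unset Printing Implicit Defensive.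

Local Open Scope group_scope.

Local Notation "x ^-1" := (sinv x) : group_scope.

(** * Inverse semigroups and their natural order *)

(** Bundling the property with the semigroup lets the theory of inverses be
    used by rewriting, without side conditions. *)
Record invSemigroup := InvSemigroup {
  inv_sort :> semigroupType;
  inv_sortP : inverse_semigroup inv_sort
}.
Arguments inv_sortP : clear implicits.

Definition idem (T : semigroupType) (e : T) := e * e = e.

Lemma inverse_ofC (T : semigroupType) (x y : T) :
  inverse_of x y -> inverse_of y x.
Proof. by case. Qed.

Lemma inverse_of_morph (S T : semigroupType) (f : {multiplicative S -> T}) x y :
  inverse_of x y -> inverse_of (f x) (f y).
Proof. by case=> xyx yxy; split; rewrite -!gmulfM ?xyx ?yxy. Qed.

Lemma morph_idem (S T : semigroupType) (f : {multiplicative S -> T}) e :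
  idem e -> idem (f e).
Proof. by rewrite /idem -gmulfM => ->. Qed.

Lemma morph_idem_inj (S T : semigroupType) (f : {multiplicative S -> T}) e :
  injective f -> idem (f e) -> idem e.
Proof. by move=> inj_f; rewrite /idem -gmulfM => /inj_f. Qed.

(** Two inverses [y], [z] of [x] satisfy [y = y(xz)(xy) = y(xy)(xz) = yxz], and
    symmetrically [z = yxz]: commuting idempotents make the inverse unique. *)
Lemma inverse_semigroup_of_idemC (T : semigroupType) :
    (forall x : T, exists y, inverse_of x y) ->
    (forall e f : T, idem e -> idem f -> e * f = f * e) ->
  inverse_semigroup T.
Proof.
move=> reg idC x; have [y [xyx yxy]] := reg x; exists y; split=> // z [xzx zxz].
have idl u : x * u * x = x -> idem (x * u) by move=> xux; rewrite /idem mulgA xux.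
have idr u : x * u * x = x -> idem (u * x).
  by move=> xux; rewrite /idem -mulgA [x * _]mulgA xux.
transitivity (y * x * z).
  rewrite -{1}yxy -{1}xzx.
  have -> : y * (x * z * x) * y = y * (x * z * (x * y)) by rewrite !mulgA.
  by rewrite (idC _ _ (idl _ xzx) (idl _ xyx)) !mulgA yxy.
rewrite -[RHS]zxz -{2}xyx.
have -> : z * (x * y * x) * z = z * x * (y * x) * z by rewrite !mulgA.
rewrite (idC _ _ (idr _ xzx) (idr _ xyx)).
have -> : y * x * (z * x) * z = y * x * (z * x * z) by rewrite !mulgA.
by rewrite zxz.
Qed.

Section InverseSemigroup.

Variable T : invSemigroup.
Implicit Types a b c d e f x y : T.

Lemma mulxVx x : x * x^-1 * x = x.
Proof. by case: (sinvP x (inv_sortP T)). Qed.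

Lemma mulVxV x : x^-1 * x * x^-1 = x^-1.
Proof. by case: (sinvP x (inv_sortP T)). Qed.

Lemma sinv_eq x y : inverse_of x y -> x^-1 = y.
Proof. by move=> xy; rewrite (sinv_unique (inv_sortP T) xy). Qed.

Lemma sinvK x : x^-1^-1 = x.
Proof. by apply/sinv_eq/inverse_ofC/sinvP/inv_sortP. Qed.

Lemma idem_sinv e : idem e -> e^-1 = e.
Proof. by move=> ee; apply: sinv_eq; split; rewrite ee. Qed.

Lemma idem_mulxV x : idem (x * x^-1).
Proof. by rewrite /idem mulgA mulxVx. Qed.

Lemma idem_mulVx x : idem (x^-1 * x).
Proof. by rewrite /idem mulgA mulVxV. Qed.

(** With [x] the inverse of [ef], the element [fxe] is also an inverse of [ef],
    hence [x = fxe], which is idempotent; an idempotent is its own inverse, so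
    [ef = x]. *)
Lemma idemM e f : idem e -> idem f -> idem (e * f).
Proof.
move=> ee ff; have := mulxVx (e * f); have := mulVxV (e * f).
have := @sinv_eq (e * f); set x := (_ * _)^-1 => uniq xefx efxef.
have fxe : x = f * x * e.
  apply: uniq; split.
    have -> : e * f * (f * x * e) * (e * f) = e * (f * f) * x * (e * e) * f.
      by rewrite !mulgA.
    by rewrite ee ff -[RHS]efxef !mulgA.
  have -> : f * x * e * (e * f) * (f * x * e) = f * (x * (e * e) * (f * f) * x) * e.
    by rewrite !mulgA.
  have -> : x * (e * e) * (f * f) * x = x by rewrite ee ff -[RHS]xefx !mulgA.
  by [].
have xx : idem x.
  rewrite /idem {1}fxe {2}fxe.
  have -> : f * x * e * (f * x * e) = f * (x * (e * f) * x) * e by rewrite !mulgA.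
  by rewrite xefx -fxe.
by have := idem_sinv xx; rewrite sinvK => ->.
Qed.

(** Both [ef] and [fe] are inverses of the idempotent [ef]. *)
Lemma idemC e f : idem e -> idem f -> e * f = f * e.
Proof.
move=> ee ff; rewrite -[LHS]idem_sinv; last exact: idemM.
have efef : e * f * (e * f) = e * f := idemM ee ff.
have fefe : f * e * (f * e) = f * e := idemM ff ee.
apply: sinv_eq; split.
  have -> : e * f * (f * e) * (e * f) = e * (f * f) * (e * e) * f by rewrite !mulgA.
  by rewrite ff ee -[RHS]efef !mulgA.
have -> : f * e * (e * f) * (f * e) = f * (e * e) * (f * f) * e by rewrite !mulgA.
by rewrite ff ee -[RHS]fefe !mulgA.
Qed.

Lemma sinvM x y : (x * y)^-1 = y^-1 * x^-1.
Proof.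
have xVx_yyV := idemC (idem_mulVx x) (idem_mulxV y).
apply: sinv_eq; split.
  have -> : x * y * (y^-1 * x^-1) * (x * y) = x * (y * y^-1 * (x^-1 * x)) * y.
    by rewrite !mulgA.
  by rewrite -xVx_yyV !mulgA mulxVx -!mulgA [y * _]mulgA mulxVx.
have -> : y^-1 * x^-1 * (x * y) * (y^-1 * x^-1) =
          y^-1 * (x^-1 * x * (y * y^-1)) * x^-1 by rewrite !mulgA.
by rewrite xVx_yyV !mulgA mulVxV -!mulgA [x^-1 * (x * _)]mulgA mulVxV.
Qed.

Lemma idem_conj x e : idem e -> idem (x * e * x^-1).
Proof.
move=> ee; rewrite /idem.
have -> : x * e * x^-1 * (x * e * x^-1) = x * (e * (x^-1 * x)) * e * x^-1.
  by rewrite !mulgA.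
rewrite (idemC ee (idem_mulVx x)) !mulgA mulxVx.
by rewrite -[x * e * e]mulgA ee.
Qed.

(** The natural partial order; for partial bijections it is restriction. *)
Definition le a b := exists2 e, idem e & a = e * b.

Lemma le_idem_mul e a : idem e -> le (e * a) a.
Proof. by exists e. Qed.

Lemma leE a b : le a b -> a = a * a^-1 * b.
Proof.
move=> [e ee ->]; rewrite sinvM (idem_sinv ee) -[in RHS]mulgA.
have -> : e * b * (b^-1 * e * b) = e * (b * b^-1 * e) * b by rewrite !mulgA.
rewrite (idemC (idem_mulxV b) ee).
have -> : e * (e * (b * b^-1)) * b = e * e * (b * b^-1 * b) by rewrite !mulgA.
by rewrite ee mulxVx.
Qed.

Lemma le_mul_idem a e : idem e -> le (a * e) a.
Proof.
move=> ee; exists (a * e * a^-1); first exact: idem_conj.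
have -> : a * e * a^-1 * a = a * (e * (a^-1 * a)) by rewrite !mulgA.
by rewrite (idemC ee (idem_mulVx a)) !mulgA mulxVx.
Qed.

Lemma le_refl a : le a a.
Proof. by exists (a * a^-1); [exact: idem_mulxV | rewrite mulxVx]. Qed.

Lemma le_trans b a c : le a b -> le b c -> le a c.
Proof.
move=> [e ee ->] [f ff ->]; exists (e * f); first exact: idemM.
by rewrite mulgA.
Qed.

Lemma leM a b c d : le a b -> le c d -> le (a * c) (b * d).
Proof.
move=> [e ee ->] [f ff ->].
have -> : e * b * (f * d) = e * (b * f * d) by rewrite !mulgA.
apply: le_trans (le_idem_mul _ ee) _.
have [g gg ->] := le_mul_idem b ff.
by rewrite -mulgA; apply: le_idem_mul.
Qed.

Lemma leV a b : le a b -> le a^-1 b^-1.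
Proof.
by move=> [e ee ->]; rewrite sinvM (idem_sinv ee); apply: le_mul_idem.
Qed.

Lemma le_anti a b : le a b -> le b a -> a = b.
Proof.
move=> [e ee ->] [f ff bfeb].
have eb : e * b = b by rewrite bfeb !mulgA -[e * f * e]mulgA (idemC ff ee) !mulgA ee.
by rewrite eb.
Qed.

Lemma le_idem a e : le a e -> idem e -> idem a.
Proof. by move=> [f ff ->] ee; apply: idemM. Qed.

End InverseSemigroup.

Section InjectiveMorphism.

Variables (V T : invSemigroup) (f : {multiplicative V -> T}).

Lemma morph_sinv v : f v^-1 = (f v)^-1.
Proof. by apply/esym/sinv_eq/inverse_of_morph/sinvP/inv_sortP. Qed.

Hypothesis inj_f : injective f.

Lemma morph_le_inj v w : le (f v) (f w) -> le v w.
Proof.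
move/leE; rewrite -morph_sinv -!gmulfM => /inj_f vw; rewrite vw.
exact: le_idem_mul (idem_mulxV v).
Qed.

End InjectiveMorphism.

(** * Partial bijections and actions *)

Definition partial_bijection (X : Type) (r : X -> X -> Prop) :=
  (forall x y y', r x y -> r x y' -> y = y') /\
  (forall x x' y, r x y -> r x' y -> x = x').

(** The elements of the symmetric inverse monoid of [X]. *)
Definition pbij (X : Type) := {r : X -> X -> Prop | partial_bijection r}.

Section PartialBijections.

Variable X : Type.
Implicit Types r s t : pbij X.

Lemma pbij_eq r s : (forall x y, sval r x y <-> sval s x y) -> r = s.
Proof.
case: r s => [r pr] [s ps] /= rs; apply: eq_exist.
by apply/funext => x; apply/funext => y; apply/propext.
Qed.

Definition rel_comp (r s : X -> X -> Prop) x z := exists2 y, r x y & s y z.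

Lemma pbij_comp_subproof r s : partial_bijection (rel_comp (sval r) (sval s)).
Proof.
case: r s => [r [rf ri]] [s [sf si]]; split=> [x y y'|x x' y] /= [z rz sz] [z' rz' sz'].
  by have zz := rf _ _ _ rz rz'; subst z'; apply: sf sz sz'.
by have zz := si _ _ _ sz sz'; subst z'; apply: ri rz rz'.
Qed.

Definition pbij_comp r s : pbij X := exist _ _ (pbij_comp_subproof r s).

Lemma pbij_compA : associative pbij_comp.
Proof.
move=> r s t; apply: pbij_eq => x y; split.
  by move=> [z rxz [w szw twy]]; exists w => //; exists z.
by move=> [w [z rxz szw] twy]; exists z => //; exists w.
Qed.

Lemma pbij_conv_subproof r : partial_bijection (fun x y => sval r y x).
Proof.
case: r => [r [rf ri]]; split=> [x y y'|x x' y] /=; first exact: ri.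
exact: rf.
Qed.

Definition pbij_conv r : pbij X := exist _ _ (pbij_conv_subproof r).

HB.instance Definition _ := gen_eqMixin (pbij X).
HB.instance Definition _ := gen_choiceMixin (pbij X).
HB.instance Definition _ := isSemigroup.Build (pbij X) pbij_compA.

Lemma pbijM r s x z : sval (r * s) x z <-> exists2 y, sval r x y & sval s y z.
Proof. by []. Qed.

Lemma pbij_inverse_of r : inverse_of r (pbij_conv r).
Proof.
split; apply: pbij_eq => x y; case: r => [r [rf ri]] /=.
  split=> [[z [w rxw rzw] rzy]|rxy]; last by exists x => //; exists y.
  by rewrite (ri _ _ _ rxw rzw).
split=> [[z [w rwx rwz] ryz]|ryx]; last by exists x => //; exists y.
by rewrite (rf _ _ _ rwx rwz).
Qed.

Lemma pbij_idem r x y : idem r -> sval r x y -> x = y.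
Proof.
move=> rr rxy; have /pbijM[z rxz rzy] : sval (r * r) x y by rewrite rr.
case: r {rr} rxy rxz rzy => [r [rf ri]] /= rxy rxz rzy.
by have yz := rf _ _ _ rxy rxz; subst z; apply: ri rxy rzy.
Qed.

(** An idempotent partial bijection is the identity of its domain, so two of
    them compose, in either order, to the identity of the intersection. *)
Lemma inverse_semigroup_pbij : inverse_semigroup (pbij X).
Proof.
apply: inverse_semigroup_of_idemC => [r|e f ee ff].
  by exists (pbij_conv r); apply: pbij_inverse_of.
apply: pbij_eq => x y; split=> /pbijM[z xz zy]; apply/pbijM.
  have xz' := pbij_idem ee xz; have zy' := pbij_idem ff zy.
  by subst z y; exists x.
have xz' := pbij_idem ff xz; have zy' := pbij_idem ee zy.
by subst z y; exists x.
Qed.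

End PartialBijections.

(** A representation of [T] by partial bijections of [X], given as ternary
    relations; injectivity of each [act t] is a consequence of [actV]. *)
Record action (T : invSemigroup) (X : Type) := Action {
  act :> T -> X -> X -> Prop;
  act_fun : forall t x y y', act t x y -> act t x y' -> y = y';
  actM : forall t u x z, act (t * u) x z <-> exists2 y, act t x y & act u y z;
  actV : forall t x y, act t x y -> act t^-1 y x
}.

Section Actions.

Variables (T : invSemigroup) (X : Type) (A : action T X).

Lemma act_inj t x x' y : A t x y -> A t x' y -> x = x'.
Proof. by move=> xy x'y; apply: act_fun (actV xy) (actV x'y). Qed.

Lemma act_idem e x y : idem e -> A e x y -> x = y.
Proof.
move=> ee xy; have: A (e * e) x y by rewrite ee.
by move=> /actM[z xz zy]; have yz := act_fun xy xz; subst z; apply: act_inj xy zy.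
Qed.

Lemma act_le t u x y : le t u -> A t x y -> A u x y.
Proof. by move=> [e ee ->] /actM[z /(act_idem ee) <-]. Qed.

Lemma act_mulxV t x y : A t x y -> A (t * t^-1) x x.
Proof. by move=> xy; apply/actM; exists y => //; apply: actV. Qed.

Definition act_pbij t : pbij X :=
  exist _ (A t) (conj (@act_fun _ _ A t) (@act_inj t)).

Lemma act_pbijM t u : act_pbij (t * u) = act_pbij t * act_pbij u.
Proof. by apply: pbij_eq => x y; apply: actM. Qed.

HB.instance Definition _ :=
  isMultiplicative.Build T (pbij X) act_pbij act_pbijM.

End Actions.

Definition faithful (T : invSemigroup) (X : Type) (A : action T X) :=
  forall t u, (forall x y, A t x y <-> A u x y) -> t = u.

Lemma act_pbij_inj (T : invSemigroup) (X : Type) (A : action T X) :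
  faithful A -> injective (act_pbij A).
Proof. by move=> fA t u tu; apply: fA => x y; have [->] := tu. Qed.

Section RegularAction.

Variable T : invSemigroup.

(** The Wagner-Preston representation: [t] acts by right multiplication, with
    domain restricted to the [x] fixed by [t t^-1], where it is injective. *)
Definition regular_rel (t x y : T) := x * (t * t^-1) = x /\ y = x * t.

Lemma regular_mul t u x z :
  regular_rel (t * u) x z <-> exists2 y, regular_rel t x y & regular_rel u y z.
Proof.
have comm := idemC (idem_mulVx t) (idem_mulxV u).
split=> [[xtu ->]|[_ [xt ->] [xtu ->]]].
  have xt : x * (t * t^-1) = x.
    rewrite -[in LHS]xtu sinvM.
    have -> : x * (t * u * (u^-1 * t^-1)) * (t * t^-1) =
              x * (t * u * (u^-1 * (t^-1 * t * t^-1))) by rewrite !mulgA.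
    by rewrite mulVxV -sinvM.
  exists (x * t); split=> //; last by rewrite mulgA.
  rewrite -[in RHS]xtu sinvM.
  have -> : x * (t * u * (u^-1 * t^-1)) * t = x * t * (u * u^-1 * (t^-1 * t)).
    by rewrite !mulgA.
  have -> : x * t * (u * u^-1 * (t^-1 * t)) = x * (t * t^-1 * t) * (u * u^-1).
    by rewrite -comm !mulgA.
  by rewrite mulxVx.
split; last by rewrite mulgA.
rewrite sinvM.
have -> : x * (t * u * (u^-1 * t^-1)) = x * t * (u * u^-1) * t^-1 by rewrite !mulgA.
by rewrite xtu -mulgA.
Qed.

Lemma regular_sinv t x y : regular_rel t x y -> regular_rel t^-1 y x.
Proof.
move=> [xt ->]; rewrite /regular_rel sinvK; split; last by rewrite -mulgA xt.
by rewrite -mulgA [t * _]mulgA mulxVx.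
Qed.

Lemma regular_fun t x y y' : regular_rel t x y -> regular_rel t x y' -> y = y'.
Proof. by move=> [_ ->] [_ ->]. Qed.

Definition regular : action T T := Action regular_fun regular_mul regular_sinv.

(** Since [t] sends [t t^-1] to [t], an element [u] acting in the same way
    satisfies [t = t t^-1 u]; hence [t] and [u] lie below each other. *)
Lemma faithful_regular : faithful regular.
Proof.
have le_of t u : (forall x y, regular t x y <-> regular u x y) -> le t u.
  move=> tu; have /tu[_ /= t_eq] : regular t (t * t^-1) t.
    by split; rewrite ?mulxVx // -mulgA [t^-1 * _]mulgA mulVxV.
  by rewrite t_eq; apply: le_idem_mul (idem_mulxV t).
by move=> t u tu; apply: le_anti; apply: le_of => // x y; rewrite tu.
Qed.

End RegularAction.

(** * Operations on actions *)

#[local] Obligation Tactic := idtac.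

Section Restriction.

Variables (V T : invSemigroup) (f : {multiplicative V -> T}).
Variables (X : Type) (A : action T X).

Program Definition restr : action V X := @Action V X (fun v => A (f v)) _ _ _.
Next Obligation. by move=> v x y y'; apply: act_fun. Qed.
Next Obligation. by move=> v w x y; rewrite /= gmulfM; apply: actM. Qed.
Next Obligation. by move=> v x y; rewrite /= morph_sinv; apply: actV. Qed.

End Restriction.

Section Transport.

Variables (T : invSemigroup) (X Y : Type) (A : action T Y).
Variables (g : X -> Y) (h : Y -> X) (gK : cancel g h) (hK : cancel h g).

Program Definition transport : action T X :=
  @Action T X (fun t x y => A t (g x) (g y)) _ _ _.
Next Obligation.
by move=> t x y y' xy xy'; apply: (can_inj gK); apply: act_fun xy xy'.
Qed.
Next Obligation.
move=> t u x z; split=> [/actM[y xy yz]|[y xy yz]]; last by apply/actM; exists (g y).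
by exists (h y); rewrite /= hK.
Qed.
Next Obligation. by move=> t x y; apply: actV. Qed.

End Transport.

Section Sum.

Variables (T : invSemigroup) (X Y : Type) (A : action T X) (B : action T Y).

Definition sum_rel t (p q : X + Y) : Prop :=
  match p, q with
  | inl x, inl x' => A t x x'
  | inr y, inr y' => B t y y'
  | _, _ => False
  end.

Program Definition sum_act : action T (X + Y) := @Action T _ sum_rel _ _ _.
Next Obligation.
by move=> t [] x [] y [] y' //= xy xy'; congr (_ _); apply: act_fun xy xy'.
Qed.
Next Obligation.
move=> t u x z; split.
  by case: x z => x [] z //= /actM[y xy yz]; [exists (inl y)|exists (inr y)].
by case: x z => x [] z [[] y] //= xy yz; apply/actM; exists y.
Qed.
Next Obligation. by move=> t [] x [] y //=; apply: actV. Qed.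

End Sum.

Section Sigma.

Variables (T : invSemigroup) (I : Type) (X : I -> Type).
Variable A : forall i, action T (X i).

(** Two points are related only inside one summand; [e] transports the first
    point to the summand of the second. *)
Definition sigma_rel t (p q : {i & X i}) : Prop :=
  exists e : tag p = tag q, A (tag q) t (eq_rect _ X (tagged p) _ e) (tagged q).

Lemma sigma_relE t i (x y : X i) :
  sigma_rel t (existT X i x) (existT X i y) <-> A i t x y.
Proof.
split=> [[/= e]|xy]; last by exists erefl.
by rewrite (Prop_irrelevance e erefl).
Qed.

Program Definition sigma_act : action T {i & X i} := @Action T _ sigma_rel _ _ _.
Next Obligation.
move=> t [i x] [j y] [k y'] [/= e xy] [/= e' xy'].
by subst j k; rewrite (act_fun xy xy').
Qed.
Next Obligation.
move=> t u [i x] [k z]; split.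
  move=> [/= e]; subst k => /= /actM[y xy yz].
  by exists (existT X i y); apply/sigma_relE.
move=> [[j y] [/= e xy] [/= e' yz]]; subst j k.
by apply/sigma_relE/actM; exists y.
Qed.
Next Obligation.
move=> t [i x] [j y] [/= e xy]; subst j.
by apply/sigma_relE/actV.
Qed.

End Sigma.

(** * Extending an action from a subsemigroup *)

Section Extension.

Variables (V T : invSemigroup) (f : {multiplicative V -> T}).
Hypothesis inj_f : injective f.
Variables (X : Type) (A : action V X).
Implicit Types (x y : X) (s t u : T) (v w : V) (a b c : X * T).

(** The pair [(x, s)] stands for the point [x (x) s] of the action of [T] induced
    by [A]. It denotes an actual point only when [ind_eq (x, s) (x, s)], that is,
    when some idempotent of [V] that fixes [x] lies below [s s^-1]; on those
    pairs [ind_eq] is the equality of the points they denote. So [ind_eq] is a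
    partial equivalence relation. *)
Definition ind_eq a b := exists2 v, A v a.1 b.1 & le (f v) (a.2 * b.2^-1).

Lemma ind_eq_sym a b : ind_eq a b -> ind_eq b a.
Proof.
move=> [v vab le_v]; exists v^-1; first exact: actV.
by have := leV le_v; rewrite morph_sinv sinvM sinvK.
Qed.

Lemma ind_eq_trans b a c : ind_eq a b -> ind_eq b c -> ind_eq a c.
Proof.
move=> [v vab le_v] [w wbc le_w]; exists (v * w); first by apply/actM; exists b.1.
rewrite gmulfM; apply: le_trans (leM le_v le_w) _.
have -> : a.2 * b.2^-1 * (b.2 * c.2^-1) = a.2 * (b.2^-1 * b.2) * c.2^-1.
  by rewrite !mulgA.
by apply: leM (le_refl _); apply: le_mul_idem; apply: idem_mulVx.
Qed.

Lemma ind_eq_mul x s y t u :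
  ind_eq (x, s) (y, t) -> ind_eq (x, s * u) (x, s * u) ->
  ind_eq (x, s * u) (y, t * u).
Proof.
move=> [v /= vxy le_v] [e /= exx le_e]; exists (e * v) => /=.
  by apply/actM; exists x.
rewrite gmulfM; apply: le_trans (leM le_e le_v) _.
rewrite !sinvM.
have -> : s * u * (u^-1 * s^-1) * (s * t^-1) =
          s * (u * u^-1 * (s^-1 * s)) * t^-1 by rewrite !mulgA.
rewrite (idemC (idem_mulxV u) (idem_mulVx s)) !mulgA mulxVx.
exact: le_refl.
Qed.

(** If [x (x) su] is a point, then so is [x (x) s], and it is in the domain of
    [u]; [ind_eq_domain] says that [u^-1] brings it back. *)
Lemma ind_eq_prefix x s u : ind_eq (x, s * u) (x, s * u) -> ind_eq (x, s) (x, s).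
Proof.
move=> [e /= exx le_e]; exists e => //=; apply: le_trans le_e _.
rewrite sinvM !mulgA; apply: leM (le_refl _).
by rewrite -[s * u * _]mulgA; apply/le_mul_idem/idem_mulxV.
Qed.

Lemma ind_eq_domain x s u :
  ind_eq (x, s * u) (x, s * u) -> ind_eq (x, s) (x, s * u * u^-1).
Proof.
move=> [e /= exx le_e]; exists e => //=; apply: le_trans le_e _.
by rewrite !sinvM sinvK !mulgA; apply: le_refl.
Qed.

(** All the pairs that denote the point [x] itself, identified with [x (x) e] for
    the idempotents [e] of [V] that fix [x]. This set is empty when no element of [V]
    is defined at [x]: then [T] will not act on [x] either. *)
Definition old_class x : set (X * T) :=
  [set a | exists2 v, A v a.1 x & le (f v) a.2].

(** The induced points outside the image of [X]. *)
Definition new_class (B : set (X * T)) :=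
  (exists2 a, B a & forall b, B b <-> ind_eq a b) /\ forall x, B <> old_class x.

Definition new_point := {B : set (X * T) | new_class B}.

Definition point_class (p : X + new_point) : set (X * T) :=
  match p with inl x => old_class x | inr B => sval B end.

Lemma point_class_eq p a b : point_class p a -> point_class p b -> ind_eq a b.
Proof.
case: p => [x|[B [[c Bc BE] newB]]] /=.
  move=> [v vax le_v] [w wbx le_w]; exists (v * w^-1).
    by apply/actM; exists x => //; apply: actV.
  by rewrite gmulfM morph_sinv; apply/leM/leV.
by move=> /BE/ind_eq_sym ca /BE; apply: ind_eq_trans.
Qed.

Lemma point_class_closed p a b : point_class p a -> ind_eq a b -> point_class p b.
Proof.
case: p => [x|[B [[c Bc BE] newB]]] /=; last first.
  by move=> /BE ca ab; apply/BE; apply: ind_eq_trans ab.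
move=> [v vax le_v] /ind_eq_sym[w wba le_w]; exists (w * v).
  by apply/actM; exists a.1.
rewrite gmulfM; apply: le_trans (leM le_w le_v) _.
by rewrite -mulgA; apply/le_mul_idem/idem_mulVx.
Qed.

(** The points [x] and [y] are images of one point under [v] and [w] with a
    common upper bound; then [v^-1 w] is idempotent, and it sends [x] to [y]. *)
Lemma old_class_inj x y a : old_class x a -> old_class y a -> x = y.
Proof.
move=> [v vax le_v] [w way le_w]; apply: (@act_idem _ _ A (v^-1 * w)).
  apply: (morph_idem_inj inj_f); rewrite gmulfM morph_sinv.
  exact: le_idem (leM (leV le_v) le_w) (idem_mulVx _).
by apply/actM; exists a.1 => //; apply: actV.
Qed.

Lemma point_class_ext p q a :
  point_class p a -> point_class q a -> point_class p = point_class q.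
Proof.
move=> pa qa; apply/funext => b; apply/propext; split=> ?.
  exact: point_class_closed qa (point_class_eq pa _).
exact: point_class_closed pa (point_class_eq qa _).
Qed.

Lemma point_class_inj p q a : point_class p a -> point_class q a -> p = q.
Proof.
move=> pa qa; have := point_class_ext pa qa.
case: p q pa qa => [x|[B newB]] [y|[C newC]] /= pa qa pq.
- by rewrite (old_class_inj pa qa).
- by have [_ /(_ x) /(_ (esym pq))] := newC.
- by have [_ /(_ y) /(_ pq)] := newB.
- by congr inr; apply: eq_exist.
Qed.

Lemma point_class_cover a : ind_eq a a -> exists p, point_class p a.
Proof.
move=> aa; have [[x xa]|no_old] := pselect (exists x, old_class x a).
  by exists (inl x).
have new_a : new_class [set b | ind_eq a b].
  split; first by exists a.
  move=> x eq_old; apply: no_old; exists x.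
  by rewrite -eq_old.
by exists (inr (exist _ _ new_a)).
Qed.

(** The action [(x (x) s) t = x (x) st], on the points of [X] and the new ones. *)
Definition ext_rel t (p q : X + new_point) :=
  exists x s, point_class p (x, s) /\ point_class q (x, s * t).

Program Definition ext : action T (X + new_point) := @Action T _ ext_rel _ _ _.
Next Obligation.
move=> t p q q' [x [s [ps qst]]] [x' [s' [ps' qst']]].
have eq_st := ind_eq_mul (point_class_eq ps ps') (point_class_eq qst qst).
exact: point_class_inj (point_class_closed qst eq_st) qst'.
Qed.
Next Obligation.
move=> t u p r; split.
  move=> [x [s [ps]]]; rewrite mulgA => rstu.
  have [q qst] := point_class_cover (ind_eq_prefix (point_class_eq rstu rstu)).
  by exists q; [exists x, s|exists x, (s * t)].
move=> [q [x [s [ps qst]]] [x' [s' [qs' rsu]]]]; exists x, s; split=> //.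
rewrite mulgA; apply: (point_class_closed rsu).
exact: ind_eq_mul (point_class_eq qs' qst) (point_class_eq rsu rsu).
Qed.
Next Obligation.
move=> t p q [x [s [ps qst]]]; exists x, (s * t); split=> //.
exact: (point_class_closed ps) (ind_eq_domain (point_class_eq qst qst)).
Qed.

(** The extension property. The substantial part is that [f v] is not defined at
    more points of [X] than [v]: if [x = x' w] with [w] below [s], and [(x', sv)]
    denotes a point because [e] fixes [x'], then [w^-1 e w] fixes [x] and lies
    below [v v^-1] in [T], hence in [V]; so [v] is defined at [x]. *)
Lemma ext_old v x q : ext (f v) (inl x) q <-> exists2 y, q = inl y & A v x y.
Proof.
split; last first.
  move=> [y -> xy]; exists x, (f (v * v^-1)); split=> /=.
    by exists (v * v^-1); [apply: act_mulxV xy|apply: le_refl].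
  by exists v => //=; rewrite -gmulfM mulxVx; apply: le_refl.
move=> [x' [s [/= [w /= wx le_w] qsv]]].
have [e /= ex' le_e] := point_class_eq qsv qsv.
have gx : A (w^-1 * e * w) x x.
  by apply/actM; exists x' => //; apply/actM; exists x' => //; apply: actV.
have le_g : le (w^-1 * e * w) (v * v^-1).
  apply: (morph_le_inj inj_f); rewrite !gmulfM !morph_sinv.
  apply: le_trans (leM (leM (leV le_w) le_e) le_w) _; rewrite sinvM.
  have -> : s^-1 * (s * f v * ((f v)^-1 * s^-1)) * s =
            s^-1 * s * (f v * (f v)^-1) * (s^-1 * s) by rewrite !mulgA.
  apply: le_trans (le_mul_idem _ (idem_mulVx s)) _.
  exact/le_idem_mul/idem_mulVx.
have /actM[y xy _] := act_le le_g gx.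
exists y => //; apply: point_class_inj qsv _ => /=.
by exists (w * v); [apply/actM; exists x|rewrite gmulfM; apply: leM (le_refl _)].
Qed.

(** Otherwise the inverse of [v] would lead out of [X]. *)
Lemma ext_new_old v B x : ~ ext (f v) (inr B) (inl x).
Proof.
by move=> Bx; have := actV Bx; rewrite -morph_sinv => /ext_old[].
Qed.

Definition new_rel v (B C : new_point) := ext (f v) (inr B) (inr C).

Program Definition new_act : action V new_point := @Action V _ new_rel _ _ _.
Next Obligation. by move=> v B C C' BC BC'; have [->] := act_fun BC BC'. Qed.
Next Obligation.
move=> v w B D; rewrite /new_rel gmulfM; split.
  by case/actM=> [[x|C]] BC CD; [have := ext_new_old BC|exists C].
by move=> [C BC CD]; apply/actM; exists (inr C).
Qed.
Next Obligation. by move=> v B C; rewrite /new_rel morph_sinv; apply: actV. Qed.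

Lemma extE v p q : ext (f v) p q <-> sum_act A new_act v p q.
Proof.
case: p q => [x|B] [y|C]; split=> //.
- by case/ext_old=> z [->].
- by move=> xy; apply/ext_old; exists y.
- by case/ext_old.
- by apply: ext_new_old.
Qed.

End Extension.

(** * Amalgamating two actions *)

Section Swindle.

Variables (V T1 T2 : invSemigroup).
Variables (f1 : {multiplicative V -> T1}) (f2 : {multiplicative V -> T2}).
Hypotheses (inj_f1 : injective f1) (inj_f2 : injective f2).
Variables (X0 : Type) (A0 : action T1 X0).

(** Carrier and action are bundled because each layer is built recursively from
    both the carrier and the action of the one before. *)
Record vset := Vset { points : Type; points_act :> action V points }.

Definition vnew (T : invSemigroup) (f : {multiplicative V -> T})
  (inj_f : injective f) (P : vset) := Vset (new_act inj_f P).

Fixpoint even_layer k : vset :=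
  if k is k'.+1 then vnew inj_f1 (vnew inj_f2 (even_layer k'))
  else Vset (restr f1 A0).

Definition odd_layer k := vnew inj_f2 (even_layer k).

(** The blocks [X_k + D_k], to be compared with [shifted], which holds the same
    points in the blocks [X_0] and [D_k + X_(k+1)]. *)
Definition total := {k & points (even_layer k) + points (odd_layer k)}%type.

Definition shifted :=
  (X0 + {k & points (odd_layer k) + points (even_layer k.+1)})%type.

Definition odd_even k (p : points (odd_layer k) + points (even_layer k.+1)) :
  shifted := inr (existT _ k p).

Definition shift_even k : points (even_layer k) -> shifted :=
  if k is k'.+1 then fun x => odd_even (inr x) else inl.

Definition shift (p : total) : shifted :=
  match tagged p with
  | inl x => shift_even x
  | inr d => odd_even (inl d)
  end.

Definition unshift (p : shifted) : total :=
  match p with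
  | inl x => existT (fun k => points (even_layer k) + points (odd_layer k))%type
               0 (inl x)
  | inr (existT k (inl d)) => existT _ k (inr d)
  | inr (existT k (inr x)) => existT _ k.+1 (inl x)
  end.

Lemma shiftK : cancel shift unshift.
Proof. by move=> [[|k] [x|d]]. Qed.

Lemma unshiftK : cancel unshift shift.
Proof. by move=> [x|[k [d|x]]]. Qed.

Definition total2 : action T2 total :=
  sigma_act (fun k => ext inj_f2 (even_layer k)).

Definition total1 : action T1 total :=
  transport (sum_act A0 (sigma_act (fun k => ext inj_f1 (odd_layer k))))
    shiftK unshiftK.

(** By [extE], on each block [V] acts as the sum of its actions on the two layers
    of the block, so regrouping the layers into other blocks does not change the
    action of [V]. *)
Lemma total_agree v p q : total1 (f1 v) p q <-> total2 (f2 v) p q.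
Proof.
have total2E : total2 (f2 v) p q <->
    sigma_act (fun k => sum_act (even_layer k) (odd_layer k)) v p q.
  by split=> -[e pq]; exists e; apply/extE.
have total1E : total1 (f1 v) p q <->
    sum_act (even_layer 0)
      (sigma_act (fun k => sum_act (odd_layer k) (even_layer k.+1)))
      v (shift p) (shift q).
  rewrite /total1 /=; case: (shift p) (shift q) => [x|p'] [y|q'] //=.
  by split=> -[e pq]; exists e; apply/extE.
apply: (iff_trans total1E); apply: iff_sym; apply: (iff_trans total2E).
case: p q {total1E total2E} => [k [x|d]] [j [y|e]].
- case: k x j y => [|k] x [|j] y; split=> //=.
  + by move/sigma_relE.
  + by move=> xy; apply/sigma_relE.
  + by case.
  + by case.
  + move=> [kj]; have /eq_add_S jk : k.+1 = j.+1 by []; subst j.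
    by rewrite (Prop_irrelevance kj erefl) => xy; apply/sigma_relE.
  + by move=> [/= kj]; subst j => xy; apply/sigma_relE.
- split=> [[/= kj]|]; first by subst j.
  by case: k x => [|k] x //= [/= kj]; subst j.
- split=> [[/= kj]|]; first by subst j.
  by case: j y => [|j] y //= [/= kj]; subst j.
- by split=> -[/= kj]; subst j => de; apply/sigma_relE.
Qed.

Lemma total1_faithful : faithful A0 -> faithful total1.
Proof.
move=> fA0 t u tu; apply: fA0 => x y.
exact: tu (unshift (inl x)) (unshift (inl y)).
Qed.

End Swindle.

Lemma faithful_sumr (T : invSemigroup) (X Y : Type) (A : action T X)
  (B : action T Y) : faithful B -> faithful (sum_act A B).
Proof. by move=> fB t u tu; apply: fB => x y; apply: (tu (inr x) (inr y)). Qed.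

Lemma faithful_suml (T : invSemigroup) (X Y : Type) (A : action T X)
  (B : action T Y) : faithful A -> faithful (sum_act A B).
Proof. by move=> fA t u tu; apply: fA => x y; apply: (tu (inl x) (inl y)). Qed.

(** The first summand of the set acted on makes the action of [T1] faithful, the
    second one that of [T2]. *)
Theorem weak_amalgamation (V T1 T2 : invSemigroup)
    (f1 : {multiplicative V -> T1}) (f2 : {multiplicative V -> T2}) :
    injective f1 -> injective f2 ->
  exists T : semigroupType, inverse_semigroup T /\ weakly_embeddable f1 f2 T.
Proof.
move=> inj1 inj2.
pose A1 := sum_act (total1 inj1 inj2 (regular T1)) (total2 inj2 inj1 (regular T2)).
pose A2 := sum_act (total2 inj1 inj2 (regular T1)) (total1 inj2 inj1 (regular T2)).
exists (pbij (total inj1 inj2 (regular T1) + total inj2 inj1 (regular T2))%type).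
split; first exact: inverse_semigroup_pbij.
exists (act_pbij A1 : {multiplicative _ -> _}).
exists (act_pbij A2 : {multiplicative _ -> _}); split.
- exact/act_pbij_inj/faithful_suml/total1_faithful/faithful_regular.
- exact/act_pbij_inj/faithful_sumr/total1_faithful/faithful_regular.
move=> v; apply: pbij_eq => -[p|p] [q|q] //=; first exact: total_agree.
by apply: iff_sym; apply: total_agree.
Qed.

(** * The inverse hull of a rich ample subsemigroup *)

Section RichAmple.

Variables (S : semigroupType) (T : invSemigroup) (phi : {multiplicative S -> T}).
Hypotheses (inj_phi : injective phi) (ample : rich_ample (range phi)).
Implicit Types x y u : S.

Lemma ample_divl x y : exists u,
  (phi x)^-1 * phi y = phi u \/ (phi x)^-1 * phi y = (phi u)^-1.
Proof.
have [rich _] := ample.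
have [[u _ <-]|[_ [u _ <-] <-]] := rich _ _ (imageT phi x) (imageT phi y).
  by exists u; left.
by exists u; right.
Qed.

Lemma ample_divr x y : exists u,
  phi x * (phi y)^-1 = phi u \/ phi x * (phi y)^-1 = (phi u)^-1.
Proof.
have [_ rich] := ample.
have [[u _ <-]|[_ [u _ <-] <-]] := rich _ _ (imageT phi x) (imageT phi y).
  by exists u; left.
by exists u; right.
Qed.

(** An idempotent in the inverse set of the range is its own inverse, so it is in
    the range. *)
Lemma ample_domain x : exists e, phi e = (phi x)^-1 * phi x.
Proof.
have [e [->|eV]] := ample_divl x x; exists e => //.
by rewrite -[RHS](idem_sinv (idem_mulVx _)) eV sinvK.
Qed.

Lemma ample_range x : exists e, phi e = phi x * (phi x)^-1.
Proof.
have [e [->|eV]] := ample_divr x x; exists e => //.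
by rewrite -[RHS](idem_sinv (idem_mulxV _)) eV sinvK.
Qed.

Lemma ample_idemC e g : idem (phi e) -> idem (phi g) -> e * g = g * e.
Proof. by move=> ee gg; apply: inj_phi; rewrite !gmulfM; apply: idemC. Qed.

(** Being inverse to each other is expressed by equations in [S], whatever the
    inverse semigroup in which [S] is embedded. *)
Lemma ample_inverse_of x y : phi y = (phi x)^-1 <-> inverse_of x y.
Proof.
split=> [xy|/(inverse_of_morph phi) /sinv_eq //].
by split; apply: inj_phi; rewrite !gmulfM xy ?mulxVx ?mulVxV.
Qed.

End RichAmple.

Section Transfer.

Variables (S : semigroupType) (T1 T2 : invSemigroup).
Variables (phi1 : {multiplicative S -> T1}) (phi2 : {multiplicative S -> T2}).
Hypotheses (inj1 : injective phi1) (inj2 : injective phi2).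
Hypotheses (ample1 : rich_ample (range phi1)) (ample2 : rich_ample (range phi2)).
Implicit Types x y u e : S.

(** Let [g] in [S] represent [x^-1 x] in [T2]. Both [e] and [g] fix [x] on the
    right, and each is minimal with this property among idempotents, one by the
    computation in [T1], the other by that in [T2]; they commute, so [e = g]. *)
Lemma transfer_domain x e :
  phi1 e = (phi1 x)^-1 * phi1 x -> phi2 e = (phi2 x)^-1 * phi2 x.
Proof.
move=> e1; have [g g2] := ample_domain ample2 x.
have xe : x * e = x by apply: inj1; rewrite gmulfM e1 mulgA mulxVx.
have xg : x * g = x by apply: inj2; rewrite gmulfM g2 mulgA mulxVx.
have eg : e * g = e by apply: inj1; rewrite gmulfM e1 -mulgA -gmulfM xg.
have ge : g * e = g by apply: inj2; rewrite gmulfM g2 -mulgA -gmulfM xe.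
have ee : idem e by apply: (morph_idem_inj inj1); rewrite e1; apply: idem_mulVx.
have gg : idem g by apply: (morph_idem_inj inj2); rewrite g2; apply: idem_mulVx.
by rewrite -g2 -ge -(ample_idemC inj1 (morph_idem _ ee) (morph_idem _ gg)) eg.
Qed.

Lemma transfer_range x e :
  phi1 e = phi1 x * (phi1 x)^-1 -> phi2 e = phi2 x * (phi2 x)^-1.
Proof.
move=> e1; have [g g2] := ample_range ample2 x.
have ex : e * x = x by apply: inj1; rewrite gmulfM e1 mulxVx.
have gx : g * x = x by apply: inj2; rewrite gmulfM g2 mulxVx.
have ge : g * e = e by apply: inj1; rewrite gmulfM e1 mulgA -gmulfM gx.
have eg : e * g = g by apply: inj2; rewrite gmulfM g2 mulgA -gmulfM ex.
have ee : idem e by apply: (morph_idem_inj inj1); rewrite e1; apply: idem_mulxV.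
have gg : idem g by apply: (morph_idem_inj inj2); rewrite g2; apply: idem_mulxV.
by rewrite -g2 -eg (ample_idemC inj1 (morph_idem _ ee) (morph_idem _ gg)) ge.
Qed.

(** The equation [u = x^-1 y] is equivalent to [(x^-1 x) u = u] together with
    [x u = (x x^-1) y], in which only elements of [S] occur. *)
Lemma transfer_divl x y u :
  phi1 u = (phi1 x)^-1 * phi1 y -> phi2 u = (phi2 x)^-1 * phi2 y.
Proof.
move=> u1; have [e e1] := ample_domain ample1 x.
have [g g1] := ample_range ample1 x.
have eu : e * u = u by apply: inj1; rewrite gmulfM e1 u1 mulgA mulVxV.
have xu : x * u = g * y by apply: inj1; rewrite !gmulfM g1 u1 mulgA.
rewrite -eu gmulfM (transfer_domain e1) -mulgA -gmulfM xu gmulfM.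
by rewrite (transfer_range g1) !mulgA mulVxV.
Qed.

Lemma transfer_divr x y u :
  phi1 u = phi1 x * (phi1 y)^-1 -> phi2 u = phi2 x * (phi2 y)^-1.
Proof.
move=> u1; have [e e1] := ample_domain ample1 y.
have [g g1] := ample_range ample1 y.
have ug : u * g = u by apply: inj1; rewrite gmulfM g1 u1 -!mulgA [_^-1 * _]mulgA mulVxV.
have uy : u * y = x * e by apply: inj1; rewrite !gmulfM e1 u1 mulgA.
rewrite -ug gmulfM (transfer_range g1) mulgA -gmulfM uy gmulfM.
by rewrite (transfer_domain e1) -!mulgA [_^-1 * _]mulgA mulVxV.
Qed.

Lemma transfer_sinv x y : phi1 y = (phi1 x)^-1 -> phi2 y = (phi2 x)^-1.
Proof. by move/(ample_inverse_of inj1)/(ample_inverse_of inj2). Qed.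

End Transfer.

(** The closure proof is a parameter of the type so that the semigroup structure
    can be inferred from the type. *)
Definition subsemigroup (G : semigroupType) (P : pred G) (_ : mulg_closed P) :=
  {x : G | P x}.

HB.instance Definition _ (G : semigroupType) (P : pred G) (PM : mulg_closed P) :=
  [isSub of subsemigroup PM for @sval G P].
HB.instance Definition _ (G : semigroupType) (P : pred G) (PM : mulg_closed P) :=
  [Choice of subsemigroup PM by <:].
HB.instance Definition _ (G : semigroupType) (P : pred G) (PM : mulg_closed P) :=
  SubChoice_isSubSemigroup.Build G P (subsemigroup PM) PM.

Lemma inverse_semigroup_sub (G : semigroupType) (P : pred G)
    (PM : mulg_closed P) :
    inverse_semigroup G -> (forall x y, inverse_of x y -> P x -> P y) ->
  inverse_semigroup (subsemigroup PM).
Proof.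
move=> invG PV x; have [y [xy uniq_y]] := invG (val x).
have Py : P y by apply: PV xy (valP x).
exists (Sub y Py); split.
  by case: xy => xyx yxy; split; apply: val_inj; rewrite !gmulfM.
by move=> z /(inverse_of_morph val) /uniq_y yz; apply: val_inj; rewrite SubK.
Qed.

Lemma inverse_of_pair (G H : semigroupType) (x y : G * H) :
  inverse_of x y <-> inverse_of x.1 y.1 /\ inverse_of x.2 y.2.
Proof.
case: x y => [x x'] [y y']; split=> [[xyx yxy]|[[xyx yxy] [xyx' yxy']]].
  by case: xyx yxy => ? ? [? ?]; do 2!split.
by split; [apply: (f_equal2 pair xyx)|apply: (f_equal2 pair yxy)].
Qed.

Lemma inverse_semigroup_prod (G H : semigroupType) :
  inverse_semigroup G -> inverse_semigroup H -> inverse_semigroup (G * H)%type.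
Proof.
move=> invG invH x; have [y [xy uniq_y]] := invG x.1.
have [z [xz uniq_z]] := invH x.2; exists (y, z).
split=> [|[y' z'] /inverse_of_pair[/uniq_y /= -> /uniq_z /= ->] //].
exact/inverse_of_pair.
Qed.

Section Hull.

Variables (S : semigroupType) (T1 T2 : invSemigroup).
Variables (phi1 : {multiplicative S -> T1}) (phi2 : {multiplicative S -> T2}).
Hypotheses (inj1 : injective phi1) (inj2 : injective phi2).
Hypotheses (ample1 : rich_ample (range phi1)) (ample2 : rich_ample (range phi2)).
Implicit Types (s u : S) (p q : T1 * T2).

(** The graph of the isomorphism between the inverse subsemigroups generated by
    the two copies of [S]. *)
Definition hull p : bool :=
  `[< exists s, p = (phi1 s, phi2 s) \/ p = ((phi1 s)^-1, (phi2 s)^-1) >].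

Lemma hull_mem s : hull (phi1 s, phi2 s).
Proof. by apply/asboolP; exists s; left. Qed.

Lemma hull_inverse p q : inverse_of p q -> hull p -> hull q.
Proof.
case: q => q1 q2 /inverse_of_pair /= [/sinv_eq <- /sinv_eq <-] /asboolP[s ps].
apply/asboolP; exists s.
by case: ps => ->; [right|left; rewrite /= !sinvK].
Qed.

(** In a mixed product the element of [S] is read off in [T1], and the transfer
    lemmas show that it also describes the product in [T2]. When the product is
    the inverse [u^-1] of an element of [S], they are applied to the inverted
    equation, such as [u = t^-1 s] for [u^-1 = s^-1 t]. *)
Lemma hullM : mulg_closed hull.
Proof.
move=> p q /asboolP[s ps] /asboolP[t qt]; apply/asboolP.
case: ps qt => -> [] ->.
- by exists (s * t); left; rewrite !gmulfM.
- have [u [u1|u1]] := ample_divr ample1 s t; exists u.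
    left; have u2 := transfer_divr inj1 inj2 ample1 ample2 (esym u1).
    exact: (f_equal2 pair u1 (esym u2)).
  right; have u1' := congr1 (@sinv T1) u1; rewrite sinvM !sinvK in u1'.
  have u2 := transfer_divr inj1 inj2 ample1 ample2 (esym u1').
  by apply: (f_equal2 pair u1); rewrite u2 sinvM sinvK.
- have [u [u1|u1]] := ample_divl ample1 s t; exists u.
    left; have u2 := transfer_divl inj1 inj2 ample1 ample2 (esym u1).
    exact: (f_equal2 pair u1 (esym u2)).
  right; have u1' := congr1 (@sinv T1) u1; rewrite sinvM !sinvK in u1'.
  have u2 := transfer_divl inj1 inj2 ample1 ample2 (esym u1').
  by apply: (f_equal2 pair u1); rewrite u2 sinvM sinvK.
- by exists (t * s); right; rewrite !gmulfM !sinvM.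
Qed.

Definition hull_invSemigroup := InvSemigroup
  (@inverse_semigroup_sub _ _ hullM
     (inverse_semigroup_prod (inv_sortP T1) (inv_sortP T2)) hull_inverse).

Local Notation V := hull_invSemigroup.

Definition hull1 (p : V) : T1 := (val (p : subsemigroup hullM)).1.
Definition hull2 (p : V) : T2 := (val (p : subsemigroup hullM)).2.

Fact hull1M (p q : V) : hull1 (p * q) = hull1 p * hull1 q.
Proof. by []. Qed.

Fact hull2M (p q : V) : hull2 (p * q) = hull2 p * hull2 q.
Proof. by []. Qed.

HB.instance Definition _ := isMultiplicative.Build V T1 hull1 hull1M.
HB.instance Definition _ := isMultiplicative.Build V T2 hull2 hull2M.

Lemma hull1_inj : injective hull1.
Proof.
move=> [p hp] [q hq] /= pq; apply: val_inj => /=; move: pq; rewrite /hull1 /=.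
move: hp hq => /asboolP[s ps] /asboolP[t qt].
case: ps qt => -> [] -> /=.
- by move/inj1 ->.
- by move=> st; rewrite st (transfer_sinv inj1 inj2 st).
- by move/esym=> st; rewrite st (transfer_sinv inj1 inj2 st).
- by move/(congr1 (@sinv T1)); rewrite !sinvK => /inj1 ->.
Qed.

Lemma hull2_inj : injective hull2.
Proof.
move=> [p hp] [q hq] /= pq; apply: val_inj => /=; move: pq; rewrite /hull2 /=.
move: hp hq => /asboolP[s ps] /asboolP[t qt].
case: ps qt => -> [] -> /=.
- by move/inj2 ->.
- by move=> st; rewrite st (transfer_sinv inj2 inj1 st).
- by move/esym=> st; rewrite st (transfer_sinv inj2 inj1 st).
- by move/(congr1 (@sinv T2)); rewrite !sinvK => /inj2 ->.
Qed.

Theorem weakly_embeddable_rich_ample :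
  exists T : semigroupType, inverse_semigroup T /\ weakly_embeddable phi1 phi2 T.
Proof.
have [T [invT [psi1 [psi2 [inj_psi1 inj_psi2 agree]]]]] :=
  weak_amalgamation hull1_inj hull2_inj.
exists T; split=> //; exists psi1, psi2; split=> // s.
pose p : subsemigroup hullM := Sub _ (hull_mem s).
exact: (agree (p : V)).
Qed.

End Hull.

(** * Amalgams over rich ample subsemigroups *)

Theorem theorem4p14 (S T1 T2 : semigroupType)
    (phi1 : {multiplicative S -> T1}) (phi2 : {multiplicative S -> T2})
    (invT1 : inverse_semigroup T1) (invT2 : inverse_semigroup T2)
    (inj1 : injective phi1) (inj2 : injective phi2)
    (ample1 : rich_ample (range phi1)) (ample2 : rich_ample (range phi2))
    (nonInvS : ~ inverse_semigroup S) :
  (exists T : semigroupType,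
      inverse_semigroup T /\ weakly_embeddable phi1 phi2 T) /\
  ~ (exists T : semigroupType,
      inverse_semigroup T /\ strongly_embeddable phi1 phi2 T).
Proof.
split.
  exact: (@weakly_embeddable_rich_ample S (InvSemigroup invT1) (InvSemigroup invT2)).
move=> [T [invT [psi1 [psi2 [_ _ agree strong]]]]]; apply: nonInvS => s.
have [y1 [sy1 uniq1]] := invT1 (phi1 s); have [y2 [sy2 _]] := invT2 (phi2 s).
(* The images of [y1] and [y2] are both the inverse of the image of [s]. *)
have [|s' [y1s' _]] := strong y1 y2.
  have [z [_ uniq_z]] := invT (psi1 (phi1 s)).
  rewrite -(uniq_z (psi1 y1)); last exact: inverse_of_morph.
  by apply: uniq_z; rewrite agree; apply: inverse_of_morph.
have inv_s u : inverse_of (phi1 s) (phi1 u) -> inverse_of s u.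
  by case=> sus usu; split; apply: inj1; rewrite !gmulfM.
exists s'; split; first by apply: inv_s; rewrite -y1s'.
by move=> u /(inverse_of_morph phi1) /uniq1; rewrite y1s' => /inj1.
Qed.
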